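(* Let $\aleph$ be an uncountable cardinal, let $\mathscr U$ be a countably incomplete, $\aleph$-good ultrafilter on a set $I$, and let $(X_i)_{i\in I}$ be a family of Banach spaces indexed by $I$. If the ultraproduct $[X_i]_{\mathscr U}$ is a Lindenstrauss space, then it is $(1,\aleph)$-injective.
   Context: All Banach spaces are real, ''operator'' means bounded linear map, ''subspace'' means closed linear subspace. $\operatorname{dens}(X)$ is the smallest cardinality of a dense subset of $X$. For an uncountable cardinal $\aleph$, a Banach space $E$ is $(1,\aleph)$-injective if for every Banach space $X$ with $\operatorname{dens}(X)<\aleph$ and every subspace $Y\subset X$, every operator $t:Y\to E$ has an extension to an operator $T:X\to E$ with $\|T\|\leq\|t\|$. Banach space ultraproduct: $\ell_\infty(X_i)$ is the space of bounded families $(x_i)\in\prod_i X_i$ with the sup norm, $c_0^{\mathscr U}(X_i)=\{(x_i)\in\ell_\infty(X_i):\lim_{\mathscr U(i)}\|x_i\|=0\}$, and $[X_i]_{\mathscr U}=\ell_\infty(X_i)/c_0^{\mathscr U}(X_i)$ with the quotient norm. An ultrafilter $\mathscr U$ on $I$ is countably incomplete if there is a decreasing sequence $(I_n)$ of members of $\mathscr U$ with $\bigcap_n I_n=\varnothing$. Let $\operatorname{fin}(S)$ be the set of finite subsets of $S$. A map $f:\operatorname{fin}(S)\to\mathscr U$ is monotone if $f(A)\supset f(B)$ whenever $A\subset B$, and multiplicative if $f(A\cup B)=f(A)\cap f(B)$ for all $A,B$. The ultrafilter $\mathscr U$ is $\aleph$-good if for every set $S$ with $|S|<\aleph$ and every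 monotone $f:\operatorname{fin}(S)\to\mathscr U$ there is a multiplicative $g:\operatorname{fin}(S)\to\mathscr U$ with $g(A)\subset f(A)$ for all $A\in\operatorname{fin}(S)$. A Banach space $X$ is an $\mathscr L_{\infty,\lambda}$-space if every finite-dimensional subspace of $X$ is contained in a finite-dimensional subspace of $X$ whose Banach--Mazur distance to the corresponding $\ell_\infty^n$ (of the same dimension) is at most $\lambda$. A Lindenstrauss space is a Banach space which is an $\mathscr L_{\infty,\lambda}$-space for all $\lambda>1$. *)

(* Defs.v *)
From HB Require Import structures.
From mathcomp Require Import all_boot all_order all_algebra finmap.
From mathcomp Require Import generic_quotient ring_quotient.
From mathcomp Require Import all_classical all_reals all_analysis.

Set Implicit Arguments.
Unset Strict Implicit.
Unset Printing Implicit Defensive.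

Import Order.TTheory GRing.Theory Num.Theory.
Import numFieldNormedType.Exports.

Local Open Scope classical_set_scope.
Local Open Scope ring_scope.

Record closed_subspace (R : numFieldType) (V : normedModType R) := ClosedSubspace {
  subspace_pred :> {pred V} ;
  subspace_submod : submod_closed subspace_pred ;
  subspace_closed : closed [set x | x \in subspace_pred]
}.

HB.instance Definition _ (R : numFieldType) (V : normedModType R)
    (Y : closed_subspace V) :=
  GRing.isSubmodClosed.Build R V (subspace_pred Y)
    (GRing.submod_closed_semi (subspace_submod Y)).

Section SubspaceType.
Context {R : realType} {V : normedModType R} (Y : closed_subspace V).

Record sub_space : predArgType := SubSpace {
  subspace_val : V ;
  subspace_valP : subspace_val \in Y
}.

HB.instance Definition _ := [isSub of sub_space for subspace_val].
HB.instance Definition _ := [Choice of sub_space by <:].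
HB.instance Definition _ := [SubChoice_isSubZmodule of sub_space by <:].
HB.instance Definition _ := [SubZmodule_isSubLmodule of sub_space by <:].

Let norm (y : sub_space) : R := `|subspace_val y|.

Let normD x y : norm (x + y) <= norm x + norm y.
Proof. exact: ler_normD. Qed.

Let normZ (a : R) x : norm (a *: x) = `|a| * norm x.
Proof. exact: normrZ. Qed.

Let norm_eq0 x : norm x = 0 -> x = 0.
Proof. by move=> /normr0_eq0 x0; apply: val_inj. Qed.

HB.instance Definition _ :=
  Lmodule_isNormed.Build R sub_space normD normZ norm_eq0.

Lemma sub_space_normE (y : sub_space) : `|y| = `|subspace_val y|.
Proof. by []. Qed.

End SubspaceType.

Section QuotientSpace.
Context {R : realType} {V : normedModType R} (N : closed_subspace V).

Definition quot_space : Type := Quotient.quot N.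

HB.instance Definition _ := GRing.Zmodule.on quot_space.

Definition quot_pi (x : V) : quot_space := \pi_(Quotient.quot N)%qT x.

Lemma quot_pi_eq x y : (quot_pi x = quot_pi y) <-> (x - y \in N).
Proof. by rewrite Quotient.idealrBE; exact: (rwP eqP). Qed.

Lemma quot_pi_surj q : exists x, quot_pi x = q.
Proof. by exists (repr q); rewrite /quot_pi reprK. Qed.

Lemma quot_piD x y : quot_pi (x + y) = quot_pi x + quot_pi y.
Proof. exact: (@Quotient.pi_add V N x y). Qed.

Lemma quot_piN x : quot_pi (- x) = - quot_pi x.
Proof. exact: (@Quotient.pi_opp V N x). Qed.

Lemma quot_pi0 : quot_pi 0 = 0.
Proof. by rewrite -[0 in LHS](subrr 0) quot_piD quot_piN subrr. Qed.

Let scale (a : R) (q : quot_space) : quot_space := quot_pi (a *: repr q).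

Let scaleE a x : scale a (quot_pi x) = quot_pi (a *: x).
Proof.
rewrite /scale; apply/quot_pi_eq; rewrite -scalerBr rpredZ//.
by apply/quot_pi_eq; rewrite /quot_pi reprK.
Qed.

Let scaleA a b q : scale a (scale b q) = scale (a * b) q.
Proof. by have [x <-] := quot_pi_surj q; rewrite !scaleE scalerA. Qed.

Let scale1 : left_id 1 scale.
Proof. by move=> q; have [x <-] := quot_pi_surj q; rewrite scaleE scale1r. Qed.

Let scaleDr : right_distributive scale +%R.
Proof.
move=> a q r; have [x <-] := quot_pi_surj q; have [y <-] := quot_pi_surj r.
by rewrite -quot_piD !scaleE scalerDr quot_piD.
Qed.

Let scaleDl q : {morph scale^~ q : a b / a + b}.
Proof.
by move=> a b; have [x <-] := quot_pi_surj q; rewrite !scaleE scalerDl quot_piD.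
Qed.

HB.instance Definition _ := GRing.Zmodule_isLmodule.Build R quot_space
  scaleA scale1 scaleDr scaleDl.

Lemma quot_piZ a x : quot_pi (a *: x) = a *: quot_pi x.
Proof. by rewrite -scaleE. Qed.

Definition quot_norm (q : quot_space) : R :=
  inf [set `|x| | x in [set x : V | quot_pi x = q]].

Let has_inf_norm q : has_inf [set `|x| | x in [set x : V | quot_pi x = q]].
Proof.
split; last by exists 0 => _ [x _ <-].
by have [x xq] := quot_pi_surj q; exists `|x|, x.
Qed.

Let norm_pi x : quot_norm (quot_pi x) <= `|x|.
Proof. by apply: ge_inf; [exact: (has_inf_norm _).2|exists x]. Qed.

Let norm_lift q (e : R) : 0 < e ->
  exists2 x, quot_pi x = q & `|x| < quot_norm q + e.
Proof.
by move=> /inf_adherent /(_ (has_inf_norm q))[_ [x xq <-] xe]; exists x.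
Qed.

Let norm_ge0 q : 0 <= quot_norm q.
Proof. by apply: lb_le_inf; [exact: (has_inf_norm _).1|move=> _ [x _ <-]]. Qed.

Let normD p q : quot_norm (p + q) <= quot_norm p + quot_norm q.
Proof.
apply/ler_addgt0Pr => e e0.
have e2 : 0 < e / 2 by rewrite divr_gt0.
have [[x <- xe] [y <- ye]] := (norm_lift p e2, norm_lift q e2).
rewrite -quot_piD (le_trans (norm_pi _))// (le_trans (ler_normD _ _))//.
by rewrite [e]splitr addrACA lerD// ltW.
Qed.

Let normZ_le (a : R) q : quot_norm (a *: q) <= `|a| * quot_norm q.
Proof.
apply/ler_addgt0Pr => e e0.
have a1 : 0 < `|a| + 1 by rewrite ltr_wpDl.
have [x <- xe] := norm_lift q (divr_gt0 e0 a1).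
rewrite -quot_piZ (le_trans (norm_pi _))// normrZ.
rewrite (le_trans (ler_wpM2l _ (ltW xe)))// mulrDr lerD2l mulrC -mulrA.
by rewrite ler_piMr ?ltW// mulrC ltr_pdivrMr// mul1r ltrDl.
Qed.

Let normZ (a : R) q : quot_norm (a *: q) = `|a| * quot_norm q.
Proof.
apply/eqP; rewrite eq_le normZ_le/=.
have [->|a0] := eqVneq a 0; first by rewrite normr0 mul0r norm_ge0.
rewrite -[in leLHS](scale1r q) -(mulVf a0) -scalerA.
by rewrite -ler_pdivlMl ?normr_gt0// -normfV.
Qed.

Let norm_eq0 q : quot_norm q = 0 -> q = 0.
Proof.
have [x <- q0] := quot_pi_surj q.
rewrite -quot_pi0; apply/quot_pi_eq; rewrite subr0.
apply: (@subspace_closed _ _ N) => B /nbhs_normP[e /= e0 eB].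
have [y yx] := norm_lift (quot_pi x) e0; rewrite q0 add0r => ye.
exists (x - y); split; first by apply/quot_pi_eq.
by apply: eB; rewrite /= opprB addrCA subrr addr0.
Qed.

HB.instance Definition _ :=
  Lmodule_isNormed.Build R quot_space normD normZ norm_eq0.

Lemma quot_normE (q : quot_space) :
  `|q| = inf [set `|x| | x in [set x : V | quot_pi x = q]].
Proof. by []. Qed.

Lemma quot_norm_le x : `|quot_pi x| <= `|x|.
Proof. exact: norm_pi. Qed.

Lemma quot_norm_lift (q : quot_space) (e : R) : 0 < e ->
  exists2 x, quot_pi x = q & `|x| < `|q| + e.
Proof. exact: norm_lift. Qed.

End QuotientSpace.

Section QuotientComplete.
Context {R : realType} {V : completeNormedModType R} (N : closed_subspace V).

Let quot_complete (F : set_system (quot_space N)) :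
  ProperFilter F -> cauchy F -> cvg F.
Proof.
move=> FF /cauchyP Fc.
have /choice[q Fq] n : exists q, F (ball q (geometric 1 (2^-1) n : R)).
  by apply: Fc; rewrite /geometric/= mul1r exprn_gt0.
have dq n : `|q n.+1 - q n| < geometric 2 (2^-1) n.
  have [r /= []] := filter_ex (filterI (Fq n) (Fq n.+1)).
  rewrite -!ball_normE/= => h1 h2.
  rewrite distrC -(subrKA r) (le_lt_trans (ler_normD _ _))//.
  rewrite [in X in _ + X]distrC (lt_le_trans (ltrD h1 h2))// /geometric/=.
  rewrite !mul1r exprS.
  rewrite -[leLHS]mul1r -[X in X + _]mul1r mul1r -mulrDl ler_wpM2r//.
  by rewrite [leRHS](_ : 2 = 1 + 1)// lerD2l invf_le1// ler1n.
have /choice[v vq] n :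
    exists v, quot_pi N v = q n.+1 - q n /\ `|v| < geometric 2 (2^-1) n.
  have e0 : 0 < geometric 2 (2^-1) n - `|q n.+1 - q n| by rewrite subr_gt0.
  have [v v1 v2] := quot_norm_lift (q n.+1 - q n) e0; exists v; split=> //.
  by rewrite (lt_le_trans v2)// addrCA subrr addr0.
have [x0 x0q] := quot_pi_surj (q 0%N).
have cv : cvgn (series v).
  apply: normed_cvg; apply: (series_le_cvg (v_ := geometric 2 (2^-1))) => //.
  - by move=> n; exact: normr_ge0.
  - by move=> n; rewrite /geometric/= mulr_ge0.
  - by move=> n; rewrite /= ltW ?(vq n).2.
  - by apply: is_cvg_geometric_series; rewrite ger0_norm// invf_lt1// ltr1n.
have piv n : quot_pi N (x0 + series v n) = q n.
  elim: n => [|n ih]; first by rewrite seriesEnat/= big_geq// addr0.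
  by rewrite seriesSr addrA quot_piD ih (vq n).1 addrCA subrr addr0.
pose x := x0 + limn (series v).
apply: (cvgP (quot_pi N x)); apply/cvg_ballP => e e0.
have h0 : geometric 1 (2^-1) n @[n --> \oo] --> (0 : R).
  by apply: cvg_geometric; rewrite ger0_norm// invf_lt1// ltr1n.
have e2 : 0 < e / 2 by rewrite divr_gt0.
have [n [n1 n2]] : exists n, `|limn (series v) - series v n| < e / 2 /\
    geometric 1 (2^-1) n < e / 2 :> R.
  have /cvgrPdist_lt/(_ _ e2) A := cv.
  move/cvgrPdist_lt : h0 => /(_ _ e2) B.
  have [n [/= n1 n2]] := filter_ex (filterI A B); exists n; split=> //.
  by rewrite (le_lt_trans (ler_norm _))// -normrN -[X in `|X|]add0r.
apply: filterS (Fq n) => r; rewrite -!ball_normE/= => rn.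
rewrite -(subrKA (q n)) (le_lt_trans (ler_normD _ _))// [e]splitr ltrD//.
  rewrite -(piv n) -quot_piN -quot_piD (le_lt_trans (quot_norm_le _ _))//.
  by rewrite /x opprD addrACA subrr add0r.
exact: lt_trans rn _.
Qed.

HB.instance Definition _ :=
  Uniform_isComplete.Build (quot_space N) quot_complete.

End QuotientComplete.

Section BoundedFamilies.
Context {R : realType} {I : Type} (X : I -> normedModType R).

Record linfty := Linfty {
  linfty_fun :> forall i, X i ;
  linfty_bounded : exists M : R, forall i, `|linfty_fun i| <= M
}.

Lemma linfty_eq (x y : linfty) : (forall i, x i = y i) -> x = y.
Proof.
case: x y => [x xb] [y yb] /= xy.
have {}xy : x = y by exact: functional_extensionality_dep.
by subst y; congr Linfty; exact: Prop_irrelevance.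
Qed.

HB.instance Definition _ := gen_eqMixin linfty.
HB.instance Definition _ := gen_choiceMixin linfty.

Let bounded0 : exists M : R, forall i, `|0 : X i| <= M.
Proof. by exists 0 => i; rewrite normr0. Qed.

Let boundedN (x : linfty) : exists M : R, forall i, `|- x i| <= M.
Proof. by have [M xM] := linfty_bounded x; exists M => i; rewrite normrN. Qed.

Let boundedD (x y : linfty) : exists M : R, forall i, `|x i + y i| <= M.
Proof.
have [M xM] := linfty_bounded x; have [M' yM'] := linfty_bounded y.
by exists (M + M') => i; rewrite (le_trans (ler_normD _ _))// lerD.
Qed.

Let boundedZ (a : R) (x : linfty) : exists M : R, forall i, `|a *: x i| <= M.
Proof.
have [M xM] := linfty_bounded x.
by exists (`|a| * M) => i; rewrite normrZ ler_wpM2l// xM.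
Qed.

Let zero := Linfty bounded0.
Let opp x := Linfty (boundedN x).
Let add x y := Linfty (boundedD x y).
Let scale a x := Linfty (boundedZ a x).

Let addA : associative add.
Proof. by move=> x y z; apply: linfty_eq => i; exact: addrA. Qed.

Let addC : commutative add.
Proof. by move=> x y; apply: linfty_eq => i; exact: addrC. Qed.

Let add0 : left_id zero add.
Proof. by move=> x; apply: linfty_eq => i; exact: add0r. Qed.

Let addN : left_inverse zero opp add.
Proof. by move=> x; apply: linfty_eq => i; exact: addNr. Qed.

HB.instance Definition _ := GRing.isZmodule.Build linfty addA addC add0 addN.

Let scaleA a b x : scale a (scale b x) = scale (a * b) x.
Proof. by apply: linfty_eq => i; exact: scalerA. Qed.

Let scale1 : left_id 1 scale.
Proof. by move=> x; apply: linfty_eq => i; exact: scale1r. Qed.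

Let scaleDr : right_distributive scale +%R.
Proof. by move=> a x y; apply: linfty_eq => i; exact: scalerDr. Qed.

Let scaleDl x : {morph scale^~ x : a b / a + b}.
Proof. by move=> a b; apply: linfty_eq => i; exact: scalerDl. Qed.

HB.instance Definition _ := GRing.Zmodule_isLmodule.Build R linfty
  scaleA scale1 scaleDr scaleDl.

Lemma linfty0E i : (0 : linfty) i = 0. Proof. by []. Qed.
Lemma linftyNE (x : linfty) i : (- x) i = - x i. Proof. by []. Qed.
Lemma linftyDE (x y : linfty) i : (x + y) i = x i + y i. Proof. by []. Qed.
Lemma linftyZE (a : R) (x : linfty) i : (a *: x) i = a *: x i.
Proof. by []. Qed.

(* If [I] is empty this is [sup set0 = 0]. *)
Definition linfty_norm (x : linfty) : R := sup [set `|x i| | i in setT].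

Let coord_le (x : linfty) i : `|x i| <= linfty_norm x.
Proof.
have [M xM] := linfty_bounded x.
by apply: ub_le_sup; [exists M => _ [j _ <-]|exists i].
Qed.

Let norm_le (x : linfty) (M : R) :
  0 <= M -> (forall i, `|x i| <= M) -> linfty_norm x <= M.
Proof.
move=> M0 xM; rewrite /linfty_norm.
have [->|/set0P ne] := eqVneq [set `|x i| | i in setT] set0.
  by rewrite sup0.
by apply: ge_sup => // _ [i _ <-].
Qed.

Let norm_ge0 (x : linfty) : 0 <= linfty_norm x.
Proof.
rewrite /linfty_norm; have [->|/set0P[_ [i _ _]]] :=
  eqVneq [set `|x i| | i in setT] set0; first by rewrite sup0.
by rewrite (le_trans _ (coord_le x i)).
Qed.

Let normD x y : linfty_norm (x + y) <= linfty_norm x + linfty_norm y.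
Proof.
apply: norm_le => [|i]; first by rewrite addr_ge0.
by rewrite (le_trans (ler_normD _ _))// lerD.
Qed.

Let normZ_le (a : R) x : linfty_norm (a *: x) <= `|a| * linfty_norm x.
Proof.
apply: norm_le => [|i]; first by rewrite mulr_ge0.
by rewrite normrZ ler_wpM2l// coord_le.
Qed.

Let normZ (a : R) x : linfty_norm (a *: x) = `|a| * linfty_norm x.
Proof.
apply/eqP; rewrite eq_le normZ_le/=.
have [->|a0] := eqVneq a 0; first by rewrite normr0 mul0r norm_ge0.
rewrite -[in leLHS](scale1r x) -(mulVf a0) -scalerA.
by rewrite -ler_pdivlMl ?normr_gt0// -normfV.
Qed.

Let norm_eq0 x : linfty_norm x = 0 -> x = 0.
Proof.
move=> x0; apply: linfty_eq => i; apply/eqP.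
by rewrite -normr_le0 -x0 coord_le.
Qed.

HB.instance Definition _ :=
  Lmodule_isNormed.Build R linfty normD normZ norm_eq0.

Lemma linfty_normE (x : linfty) : `|x| = sup [set `|x i| | i in setT].
Proof. by []. Qed.

Lemma linfty_coord_le (x : linfty) i : `|x i| <= `|x|.
Proof. exact: coord_le. Qed.

Lemma linfty_norm_le (x : linfty) (M : R) :
  0 <= M -> (forall i, `|x i| <= M) -> `|x| <= M.
Proof. exact: norm_le. Qed.

End BoundedFamilies.

Section BoundedFamiliesComplete.
Context {R : realType} {I : Type} (X : I -> completeNormedModType R).

Let linfty_complete (F : set_system (linfty X)) :
  ProperFilter F -> cauchy F -> cvg F.
Proof.
move=> FF /cauchyP Fc.
have coord i : cvg ((fun x : linfty X => x i) @ F).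
  apply: cauchy_cvg; apply/cauchyP => e e0; have [x Fx] := Fc e e0.
  exists (x i); have := Fx; apply: (@filterS _ F) => z.
  rewrite /= -!ball_normE /=; apply: le_lt_trans.
  exact: (linfty_coord_le (x - z)).
pose y i : X i := lim ((fun x : linfty X => x i) @ F).
have near_y (e : R) (x : linfty X) :
    F (ball x e) -> forall i, `|y i - x i| <= e.
  move=> Fx i; apply/ler_addgt0Pr => d d0.
  have /cvgrPdist_lt/(_ _ d0) yd := coord i.
  have [z [/= z1]] := filter_ex (filterI yd Fx); rewrite -ball_normE/= => z2.
  rewrite -(subrKA (z i)) (le_trans (ler_normD _ _))// addrC lerD ?ltW//.
  rewrite distrC (le_lt_trans _ z2)//; exact: (linfty_coord_le (x - z)).
have yb : exists M : R, forall i, `|y i| <= M.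
  have [x Fx] := Fc 1 ltr01; exists (1 + `|x|) => i.
  rewrite -(subrK (x i) (y i)) (le_trans (ler_normD _ _))// lerD ?near_y//.
  exact: linfty_coord_le.
apply: (cvgP (Linfty yb)); apply/cvg_ballP => e e0.
have e2 : 0 < e / 2 by rewrite divr_gt0.
have [x Fx] := Fc _ e2.
apply: filterS (Fx) => z; rewrite -!ball_normE/= => zx.
rewrite -(subrKA x) (le_lt_trans (ler_normD _ _))// [e]splitr ler_ltD//.
by apply: linfty_norm_le => [|i]; [exact: ltW|exact: near_y].
Qed.

HB.instance Definition _ :=
  Uniform_isComplete.Build (linfty X) linfty_complete.

End BoundedFamiliesComplete.

Section Ultraproduct.
Context {R : realType} {I : Type} (U : set_system I).

Section NullFamilies.
Variable X : I -> normedModType R.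

Definition c0_pred (x : linfty X) : bool :=
  `[< `|x i| @[i --> U] --> (0 : R) >].

Context {FU : Filter U}.

Let c0P (x : linfty X) :
  x \in (c0_pred : {pred _}) <->
  forall e, 0 < e -> \forall i \near U, `|x i| < e.
Proof.
split=> [/asboolP/cvgrPdist_lt x0 e /x0|x0].
  by apply: filterS => i; rewrite sub0r normrN normr_id.
apply/asboolP/cvgrPdist_lt => e /x0.
by apply: filterS => i; rewrite sub0r normrN normr_id.
Qed.

Let c0_submod : submod_closed c0_pred.
Proof.
split=> [|a x y /c0P x0 /c0P y0].
  by apply/c0P => e e0; apply: nearW => i; rewrite normr0.
apply/c0P => e e0.
have a1 : 0 < `|a| + 1 by rewrite ltr_wpDl.
have e2 : 0 < e / 2 by rewrite divr_gt0.
apply: filterS2 (x0 _ (divr_gt0 e2 a1)) (y0 _ e2) => i xi yi.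
rewrite (le_lt_trans (ler_normD _ _))// [e]splitr ler_ltD// normrZ.
rewrite (le_trans (ler_wpM2l _ (ltW xi)))// mulrCA ler_piMr ?ltW//.
by rewrite ltr_pdivrMr// mul1r ltrDl.
Qed.

Let c0_closed : closed [set x | x \in (c0_pred : {pred _})].
Proof.
move=> x xcl; apply/c0P => e e0.
have e2 : 0 < e / 2 by rewrite divr_gt0.
have [y [/= /c0P y0]] := xcl _ (nbhsx_ballx x _ e2).
rewrite -ball_normE/= => xy.
apply: filterS (y0 _ e2) => i yi.
rewrite -(subrK (y i) (x i)) (le_lt_trans (ler_normD _ _))// [e]splitr ltrD//.
by rewrite (le_lt_trans _ xy)//; exact: (linfty_coord_le (x - y)).
Qed.

Definition c0 : closed_subspace (linfty X) := ClosedSubspace c0_submod c0_closed.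

End NullFamilies.

Definition ultraproduct {UU : UltraFilter U} (X : I -> completeNormedModType R)
  : completeNormedModType R := quot_space (c0 X).

End Ultraproduct.

Arguments ultraproduct {R I} U {UU} X.

(* A cardinal is given by a type [K] having it as its cardinality. *)
Definition card_lt (S T : Type) (A : set S) (B : set T) : Prop :=
  (A #<= B)%card /\ ~ (B #<= A)%card.

(* [dens(V) < |K|], where [D] realizes the least cardinality of a dense set. *)
Definition dens_lt (V : topologicalType) (K : Type) : Prop :=
  exists D : set V,
    [/\ dense D,
        forall D' : set V, dense D' -> (D #<= D')%card &
        card_lt D [set: K]].

Definition countably_incomplete (I : Type) (U : set_system I) : Prop :=
  exists A : nat -> set I,
    [/\ forall n, U (A n),
        forall n, A n.+1 `<=` A n &
        \bigcap_n A n = set0].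

Definition fin_monotone (I : Type) (S : choiceType) (f : {fset S} -> set I) :=
  forall A B : {fset S}, (A `<=` B)%fset -> f B `<=` f A.

Definition fin_multiplicative (I : Type) (S : choiceType)
    (g : {fset S} -> set I) :=
  forall A B : {fset S}, g (A `|` B)%fset = g A `&` g B.

(* Every type carries a [choiceType] structure, see [gen_choiceMixin]. *)
Definition aleph_good (K I : Type) (U : set_system I) : Prop :=
  forall S : choiceType, card_lt [set: S] [set: K] ->
  forall f : {fset S} -> set I,
    (forall A, U (f A)) -> fin_monotone f ->
  exists g : {fset S} -> set I,
    [/\ forall A, U (g A), fin_multiplicative g & forall A, g A `<=` f A].

Section Operators.
Context {R : realType}.
Implicit Types V W : normedModType R.

Definition bounded_op V W (f : V -> W) : Prop := bounded_near f (nbhs (0 : V)).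

Definition opnorm V W (f : V -> W) : R :=
  sup [set `|f x| | x in [set x : V | `|x| <= 1]].

(* The value is [+oo] if [V] and [W] are not isomorphic. *)
Definition banach_mazur V W : \bar R :=
  ereal_inf [set d | exists (T : {linear V -> W}) (S : {linear W -> V}),
    [/\ bounded_op T, bounded_op S, cancel T S, cancel S T &
        d = (opnorm T * opnorm S)%:E]].

Definition has_dim V (n : nat) : Prop := inhabited (Vector.axiom n V).

Definition Linfty_lambda_space (V : completeNormedModType R) (lambda : R)
  : Prop :=
  forall F : closed_subspace V, (exists m, has_dim (sub_space F) m) ->
  exists (G : closed_subspace V) (n : nat),
    [/\ {subset F <= G}, has_dim (sub_space G) n &
        (* the library norm on matrices is the sup norm *)
        (banach_mazur (sub_space G) 'rV[R]_n <= lambda%:E)%E].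

Definition lindenstrauss (V : completeNormedModType R) : Prop :=
  forall lambda : R, 1 < lambda -> Linfty_lambda_space V lambda.

(* [(1, |K|)]-injectivity *)
Definition aleph_injective (K : Type) (E : completeNormedModType R) : Prop :=
  forall X : completeNormedModType R, dens_lt X K ->
  forall (Y : closed_subspace X) (t : {linear sub_space Y -> E}), bounded_op t ->
  exists T : {linear X -> E},
    [/\ bounded_op T, forall y : sub_space Y, T (subspace_val y) = t y &
        opnorm T <= opnorm t].

End Operators.

(* Main.v *)
(** By Zorn's lemma it suffices to extend by one vector [x], that is, to find a
    point in all balls of centre [t w] and radius [M |x - w|], with [w] in the
    current domain. It is enough to let [w] run through a family indexed by
    [D * nat], with [D] dense and smaller than the cardinal. Finitely many of
    these balls meet up to any tolerance in a Lindenstrauss space: through an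
    almost isometry onto [l_infty^n] this is the one-dimensional Helly theorem,
    one coordinate at a time. Goodness of the ultrafilter then attaches to every
    index [i] a finite set of balls to be met in [X i], growing along the
    ultrafilter and with tolerance tending to 0; the chosen points represent a
    common point of all the balls. *)

From HB Require Import structures.
Require Import Defs.
From mathcomp Require Import all_boot all_order all_algebra.
From mathcomp Require Import all_classical all_reals all_analysis.
From mathcomp Require Import finmap ring lra.

Set Implicit Arguments.
Unset Strict Implicit.
Unset Printing Implicit Defensive.

Import Order.TTheory GRing.Theory Num.Theory.
Import numFieldNormedType.Exports.

Local Open Scope classical_set_scope.
Local Open Scope ring_scope.

(** * Bounded operators and the operator norm *)

Section Opnorm.
Context {R : realType} {V W : normedModType R} (f : {linear V -> W}).

Lemma opnorm_has_ub : bounded_op f ->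
  has_ubound [set `|f x| | x in [set x : V | `|x| <= 1]].
Proof.
move=> /linear_boundedP[M [_ fM]]; exists (`|M| + 1) => _ [x /= x1 <-].
apply: (le_trans (fM (`|M| + 1) _ x)).
  by rewrite (le_lt_trans (ler_norm _))// ltrDl.
by rewrite ler_piMr// addr_ge0.
Qed.

Lemma opnorm_ge0 : bounded_op f -> 0 <= opnorm f.
Proof.
move=> fb; apply: (ub_le_sup (opnorm_has_ub fb)).
by exists 0; rewrite /= ?linear0 ?normr0.
Qed.

Lemma le_opnorm v : bounded_op f -> `|f v| <= opnorm f * `|v|.
Proof.
move=> fb; have [->|v0] := eqVneq v 0; first by rewrite linear0 !normr0 mulr0.
have nv : 0 < `|v| by rewrite normr_gt0.
rewrite -ler_pdivrMr// mulrC -[X in X * _]gtr0_norm ?invr_gt0// -normrZ -linearZ.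
apply: (ub_le_sup (opnorm_has_ub fb)); exists (`|v|^-1 *: v) => //=.
by rewrite normrZ gtr0_norm ?invr_gt0// mulVf// gt_eqF.
Qed.

Lemma bounded_opP M : (forall v, `|f v| <= M * `|v|) -> bounded_op f.
Proof.
move=> fM; apply/linear_boundedP; exists M; split=> [|r Mr v]; first exact: num_real.
by rewrite (le_trans (fM v))// ler_wpM2r// ltW.
Qed.

Lemma opnorm_le M : 0 <= M -> (forall v, `|f v| <= M * `|v|) -> opnorm f <= M.
Proof.
move=> M0 fM; apply: ge_sup.
  by exists `|f 0|, 0; rewrite //= normr0.
by move=> _ [x /= x1 <-]; rewrite (le_trans (fM x))// ler_piMr.
Qed.

End Opnorm.

(** * Finite-dimensional subspaces of a normed space *)

Section FiniteDimensional.
Context {R : realType}.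

(** The multiples of [u] within distance 1 of [v] have coefficients in a bounded segment, whose
    image is compact, hence closed. *)
Lemma closed_line (V : normedModType R) (u : V) :
  closed [set v | exists a : R, v = a *: u].
Proof.
have [->|u0] := eqVneq u 0.
  rewrite (_ : mkset _ = [set 0]).
    exact: (accessible_closed_set1 (hausdorff_accessible (@norm_hausdorff _ V))).
  by apply/seteqP; split=> v /= => [[a ->]|->]; [rewrite scaler0|exists 0; rewrite scaler0].
have nu : 0 < `|u| by rewrite normr_gt0.
move=> v vcl; pose M := (`|v| + 1) / `|u|.
have cM : compact [set a *: u | a in `[- M, M]].
  apply: continuous_compact; last exact: segment_compact.
  by apply: continuous_subspaceT => a; exact: scalel_continuous.
have [|a _ <-] := compact_closed (@norm_hausdorff _ V) cM (t := v); last by exists a.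
move=> B Bv.
have [_ [[a ->] [aB av]]] := vcl _ (filterI Bv (nbhsx_ballx v 1 ltr01)).
exists (a *: u); split=> //; exists a => //=.
rewrite in_itv/= -ler_norml /M ler_pdivlMr// -normrZ.
move: av; rewrite -ball_normE/= => av.
rewrite -(subrK v (a *: u)) addrC (le_trans (ler_normD _ _))// lerD2l.
by rewrite distrC ltW.
Qed.

Lemma quot_pi_continuous (V : normedModType R) (N : closed_subspace V) :
  continuous (quot_pi N).
Proof.
move=> v; apply/cvgrPdist_lt => e e0.
have /cvgrPdist_lt/(_ e e0) := @cvg_id _ (nbhs v).
by apply: filterS => w; apply: le_lt_trans; rewrite -quot_piN -quot_piD quot_norm_le.
Qed.

Lemma submod_closed_range (V W : lmodType R) (g : {linear V -> W}) :
  submod_closed [pred w | `[< exists v, g v = w >]].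
Proof.
split=> [|a x y /asboolP[v <-] /asboolP[w <-]].
  by apply/asboolP; exists 0; rewrite linear0.
by apply/asboolP; exists (a *: v + w); rewrite linearP.
Qed.

Lemma range_subspaceP (V W : normedModType R) (g : {linear V -> W}) :
  closed [set w | exists v, g v = w] ->
  exists Z : closed_subspace W, forall w, w \in Z <-> exists v, g v = w.
Proof.
rewrite (_ : mkset _ = [set w | w \in [pred w | `[< exists v, g v = w >]]]).
  move=> gcl; exists (ClosedSubspace (submod_closed_range g) gcl) => w.
  by split=> [/asboolP//|?]; exact/asboolP.
by apply/seteqP; split=> w /= => [?|/asboolP//]; exact/asboolP.
Qed.

Lemma has_dim_range (V : normedModType R) n (g : {linear 'rV[R]_n -> V})
    (Z : closed_subspace V) :
  injective g -> (forall v, v \in Z <-> exists a, g a = v) ->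
  has_dim (sub_space Z) n.
Proof.
move=> ginj ZE.
have /choice[h hE] (z : sub_space Z) : exists a, g a = subspace_val z.
  by apply/ZE; exact: subspace_valP.
have gZ a : g a \in Z by apply/ZE; exists a.
constructor; exists h.
  by move=> a x y; apply: ginj; rewrite linearP !hE.
exists (fun a => SubSpace (gZ a)) => [z|a]; last by apply: ginj; rewrite hE.
by apply: val_inj; rewrite /= hE.
Qed.

(* A sum of a closed subspace and a line is closed, as the preimage of a line of
   the quotient; spaces are grown from [0] one vector at a time. *)
Lemma finite_dim_span (V : normedModType R) (s : seq V) :
  exists (n : nat) (g : {linear 'rV[R]_n -> V}),
    [/\ injective g, closed [set v | exists a, g a = v] &
        forall v, v \in s -> exists a, g a = v].
Proof.
elim: s => [|x s [n [g [ginj gcl gs]]]].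
  exists 0%N, (\0 : {linear 'rV[R]_0 -> V}); split=> //.
    by move=> a b _; apply/rowP => -[].
  rewrite (_ : mkset _ = [set 0]).
    exact: (accessible_closed_set1 (hausdorff_accessible (@norm_hausdorff _ V))).
  by apply/seteqP; split=> v /= => [[a <-]|->]//; exists 0.
have [gx|gx] := pselect (exists a, g a = x).
  by exists n, g; split=> // v; rewrite inE => /predU1P[->|/gs].
have [N NE] := range_subspaceP gcl.
pose g' (a : 'rV[R]_(1 + n)) := a 0 0 *: x + g (rsubmx a).
have g'lin : linear g'.
  move=> c a b; rewrite /g' !mxE linearP linearP scalerDl scalerDr -scalerA.
  by rewrite addrACA.
pose G : {linear 'rV[R]_(1 + n) -> V} :=
  HB.pack g' (GRing.isLinear.Build _ _ _ _ g' g'lin).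
(* A nonzero coefficient of [x] would put [x] in the range of [g]. Injectivity of [g'] thus reduces
   to that of [g]. *)
have g0E a : g' a = 0 -> a 0 0 = 0.
  move=> a0; apply/eqP; apply: contra_notT gx => na.
  exists (- (a 0 0)^-1 *: rsubmx a); rewrite linearZ/=.
  move/eqP: a0; rewrite /g' addrC addr_eq0 => /eqP ->.
  by rewrite scaleNr scalerN opprK scalerA mulVf// scale1r.
have row0E a b : (row_mx (a%:M : 'rV_1) b : 'rV[R]_(1 + n)) 0 0 = a.
  have := row_mxEl (a%:M : 'rV_1) b 0 0; rewrite [RHS]mxE eqxx mulr1n => E.
  by rewrite -[RHS]E; congr (row_mx _ _ _ _); exact: val_inj.
exists (1 + n)%N, G; split=> [|v vcl|v].
- apply: raddf_inj => a /= a0.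
  have a00 := g0E _ a0.
  move: a0; rewrite /g' a00 scale0r add0r -(linear0 g) => /ginj ra0.
  apply/rowP => j; rewrite mxE; case: (split_ordP j) => k ->.
    by rewrite (_ : lshift n k = 0) ?a00//; apply/val_inj; case: k => -[].
  by have := congr1 (fun u : 'rV_n => u 0 k) ra0; rewrite !mxE.
- have [|a va] := closed_line (u := quot_pi N x) (t := quot_pi N v).
    move=> B /quot_pi_continuous/vcl[_ [[b <-] Bb]].
    exists (quot_pi N (g' b)); split=> //; exists (b 0 0).
    rewrite -quot_piZ; apply/quot_pi_eq; rewrite /g' addrC addKr.
    by apply/NE; exists (rsubmx b).
  move: va; rewrite -quot_piZ => /quot_pi_eq/NE[b bE].
  exists (row_mx (a%:M : 'rV_1) b) => /=; rewrite /g' row_mxKr bE.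
  by rewrite row0E subrKC.
- rewrite inE => /predU1P[->|/gs[a <-]].
    exists (row_mx (1%:M : 'rV_1) 0) => /=; rewrite /g' row_mxKr linear0 addr0.
    by rewrite row0E scale1r.
  exists (row_mx (0%:M : 'rV_1) a) => /=; rewrite /g' row_mxKr.
  by rewrite row0E scale0r add0r.
Qed.

(** Supplies the subspace [F] to which [Linfty_lambda_space] is applied, [s] being a list of
    centres. *)
Lemma finite_dim_hull (V : normedModType R) (s : seq V) :
  exists F : closed_subspace V,
    (exists m, has_dim (sub_space F) m) /\ {subset s <= F}.
Proof.
have [n [g [ginj /range_subspaceP[F FE] gs]]] := finite_dim_span s.
exists F; split; first by exists n; exact: has_dim_range FE.
by move=> v /gs/FE.
Qed.

End FiniteDimensional.

(** * Intersections of balls in the line, in [l_infty^n] and in Lindenstrauss spaces *)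

Section BallIntersection.
Context {R : realType}.

(** Every left end [c p - r p] lies below every right end [c q + r q], so the supremum of the left
    ends is in all the intervals. *)
Lemma interval_helly (T : Type) (A : set T) (c r : T -> R) :
  (forall p q, A p -> A q -> `|c p - c q| <= r p + r q) ->
  exists v, forall p, A p -> `|v - c p| <= r p.
Proof.
move=> cr; exists (sup [set c p - r p | p in A]) => p Ap.
have ub q : A q -> ubound [set c p - r p | p in A] (c q + r q).
  move=> Aq _ [p' Ap' <-]; have := cr _ _ Ap' Aq.
  by rewrite ler_norml => /andP[_]; lra.
rewrite ler_distl; apply/andP; split.
  by apply: ub_le_sup; [exists (c p + r p); exact: ub|exists p].
by apply: ge_sup; [exists (c p - r p), p|exact: ub].
Qed.

Lemma rV_norm_le n (v : 'rV[R]_n) (M : R) :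
  0 <= M -> (forall j, `|v 0 j| <= M) -> `|v| <= M.
Proof.
move=> M0 vM; rewrite [leLHS]mx_normrE; apply: bigmax_le => // -[i j] _ /=.
by rewrite ord1.
Qed.

Lemma rV_coord_le n (v : 'rV[R]_n) j : `|v 0 j| <= `|v|.
Proof.
rewrite [leRHS]mx_normrE.
exact: (le_bigmax _ (fun ij : 'I_1 * 'I_n => `|v ij.1 ij.2|) (0, j)).
Qed.

(** Balls of the sup norm are products of intervals, so a common point can be chosen
    coordinatewise. *)
Lemma rV_helly n (T : Type) (A : set T) (c : T -> 'rV[R]_n) (r : T -> R) :
  (forall p q, A p -> A q -> `|c p - c q| <= r p + r q) ->
  exists v, forall p, A p -> `|v - c p| <= r p.
Proof.
move=> cr.
have /choice[v vP] (j : 'I_n) :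
    exists x, forall p, A p -> `|x - c p 0 j| <= r p.
  apply: interval_helly => p q Ap Aq; rewrite (le_trans _ (cr _ _ Ap Aq))//.
  by have := rV_coord_le (c p - c q) j; rewrite !mxE.
exists (\row_j v j) => p Ap; apply: rV_norm_le => [|j].
  have := cr _ _ Ap Ap; rewrite subrr normr0; lra.
by rewrite !mxE vP.
Qed.

(** Let [A] map a space containing the centres onto [l_infty^n], with inverse [B]. Radii multiplied
    by [opnorm A] keep the images pairwise compatible, and pulling a common point back by [B] costs
    a factor [opnorm A * opnorm B] on the radii. *)
Lemma lindenstrauss_finite_balls (E : completeNormedModType R) (s : seq (E * R))
    (e : R) : lindenstrauss E -> 0 < e ->
  (forall p q, p \in s -> q \in s -> `|p.1 - q.1| <= p.2 + q.2) ->
  exists z, forall p, p \in s -> `|z - p.1| <= p.2 + e.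
Proof.
move=> EL e0 sE.
have s0 p : p \in s -> 0 <= p.2.
  by move=> ps; have := sE _ _ ps ps; rewrite subrr normr0; lra.
have [M [M0 sM]] : exists M, 0 <= M /\ forall p, p \in s -> p.2 <= M.
  elim: {sE} s s0 => [|p s ih] s0; first by exists 0.
  have [|M [M0 sM]] := ih; first by move=> q qs; rewrite s0// inE qs orbT.
  exists (M + p.2); have p0 : 0 <= p.2 by rewrite s0// mem_head.
  by split=> [|q]; [lra|rewrite inE => /predU1P[->|/sM]; lra].
(* The excess over a radius [p.2] will be [2 * d * p.2], at most [e]. The [+ 1] keeps the
   denominator positive if [M = 0]. *)
pose d := e / (2 * (M + 1)).
have d0 : 0 < d by rewrite divr_gt0//; lra.
have [F [Fdim sF]] := finite_dim_hull [seq p.1 | p <- s].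
have [|G [n [FG _ BM]]] := EL (1 + d) _ F Fdim; first by lra.
(* Relaxing [1 + d] to [1 + 2 * d] makes the inequality strict, so that the infimum yields actual
   operators. *)
have : (banach_mazur (sub_space G) 'rV[R]_n < (1 + 2 * d)%:E)%E.
  by rewrite (le_lt_trans BM)// lte_fin; lra.
move=> /ereal_inf_lt[_ [A [B [Ab Bb AK _ ->]]]]; rewrite lte_fin => ABd.
have pG p : p \in s -> p.1 \in G by move=> ps; apply/FG/sF/map_f.
pose c (p : E * R) : sub_space G := insubd 0 p.1.
have cE p : p \in s -> subspace_val (c p) = p.1.
  by move=> ps; rewrite /c -[LHS]/(val _) insubdK//; exact: pG.
have [p q ps qs|v vP] := @rV_helly n _ [set p | p \in s] (A \o c)
  (fun p => opnorm A * p.2).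
  rewrite /= -linearB (le_trans (le_opnorm _ Ab))// -mulrDr.
  by rewrite ler_wpM2l ?opnorm_ge0// sub_space_normE/= !cE// sE.
exists (subspace_val (B v)) => p ps.
have : `|B v - c p| <= (1 + 2 * d) * p.2.
  rewrite -[X in B v - X]AK -linearB (le_trans (le_opnorm _ Bb))//.
  rewrite (le_trans (ler_wpM2l (opnorm_ge0 Bb) (vP _ ps)))// mulrA.
  by rewrite [opnorm B * _]mulrC ler_wpM2r ?s0// ltW.
rewrite sub_space_normE/= cE// => /le_trans; apply.
rewrite mulrDl mul1r lerD2l (@le_trans _ _ (2 * d * (M + 1)))//.
  by rewrite ler_wpM2l//; [lra|have := sM _ ps; lra].
rewrite (_ : 2 * d * (M + 1) = e)// /d; field.
by rewrite gt_eqF//; lra.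
Qed.

End BallIntersection.

(** * The norm of an ultraproduct in terms of representatives *)

Section UltraproductNorm.
Context {R : realType} {I : Type} (U : set_system I) {FU : Filter U}.
Variable X : I -> normedModType R.

Lemma mem_c0P (x : linfty X) :
  x \in @c0 R I U X _ <-> forall e, 0 < e -> \forall i \near U, `|x i| < e.
Proof.
split=> [/asboolP/cvgrPdist_lt x0 e /x0|x0].
  by apply: filterS => i; rewrite sub0r normrN normr_id.
apply/asboolP/cvgrPdist_lt => e /x0.
by apply: filterS => i; rewrite sub0r normrN normr_id.
Qed.

(** Some lift [y] of the same class has norm below [M], and [x - y] is eventually smaller than the
    gap [M - |y|]. *)
Lemma near_coord_lt (x : linfty X) (M : R) :
  `|quot_pi (@c0 R I U X _) x| < M -> \forall i \near U, `|x i| < M.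
Proof.
rewrite -subr_gt0 => /(quot_norm_lift (quot_pi (@c0 R I U X _) x))[y yx].
rewrite addrC subrK -subr_gt0 => yM.
have /esym/quot_pi_eq/mem_c0P/(_ _ yM) := yx; apply: filterS => i xy.
rewrite -(subrK (y i) (x i)) (le_lt_trans (ler_normD _ _))//.
by rewrite -ltrBrDr (lt_le_trans xy)// lerD2l lerN2 linfty_coord_le.
Qed.

(** Replacing by 0 the coordinates of norm above [M + e] changes [x] only off a member of [U]. The
    class is the same and the sup norm becomes at most [M + e]. *)
Lemma quot_norm_near_le (x : linfty X) (M : R) : 0 <= M ->
  (forall e, 0 < e -> \forall i \near U, `|x i| <= M + e) ->
  `|quot_pi (@c0 R I U X _) x| <= M.
Proof.
move=> M0 xM; apply/ler_addgt0Pr => e e0.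
pose y i : X i := if `|x i| <= M + e then x i else 0.
have ye i : `|y i| <= M + e.
  by rewrite /y; case: ifPn => // _; rewrite normr0 addr_ge0// ltW.
have yb : exists N : R, forall i, `|y i| <= N by exists (M + e).
have -> : quot_pi (@c0 R I U X _) x = quot_pi (@c0 R I U X _) (Linfty yb).
  apply/quot_pi_eq/mem_c0P => d d0; apply: filterS (xM e e0) => i xi.
  by rewrite /= /y xi subrr normr0.
rewrite (le_trans (quot_norm_le _ _))//.
by apply: linfty_norm_le => //; rewrite addr_ge0// ltW.
Qed.

End UltraproductNorm.

(** * Goodness of the ultrafilter and ball intersections in the ultraproduct *)

Lemma near_seq (I : Type) (U : set_system I) (FU : Filter U) (T : eqType)
    (s : seq T) (Q : T -> set I) :
  (forall p, p \in s -> U (Q p)) -> U [set i | forall p, p \in s -> Q p i].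
Proof.
elim: s => [|p s ih] sQ; first by apply: nearW.
have /ih : forall q, q \in s -> U (Q q).
  by move=> q qs; apply: sQ; rewrite inE qs orbT.
apply: filterS2 (sQ p (mem_head _ _)) => i Qp Qs q.
by rewrite inE => /predU1P[->|/Qs].
Qed.

Section Multiplicative.
Context {I : Type} {S : choiceType} (g : {fset S} -> set I).
Hypothesis gM : fin_multiplicative g.

Lemma fin_multiplicative1 B s : s \in B -> g B `<=` g [fset s]%fset.
Proof.
move=> sB i; have -> : B = ([fset s] `|` B)%fset.
  by apply/esym/fsetUidPr; rewrite fsub1set.
by rewrite gM => -[].
Qed.

(** A nonempty finite set is the union of its singletons. For [fset0] the conclusion can fail, since
    [g fset0] may be a proper subset of [I]. *)
Lemma fin_multiplicative_mem B i : B != fset0 ->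
  (forall s, s \in B -> g [fset s]%fset i) -> g B i.
Proof.
elim/finSet_rect: B => B ih B0 Bi; have /fset0Pn[s sB] := B0.
rewrite -(fsetD1K sB) gM; split; first exact: Bi.
have [->|B's] := eqVneq (B `\ s)%fset fset0.
  (* The goal is now [g fset0 i], and [[fset s]] is its own union with [fset0]. *)
  by have := Bi s sB; rewrite -[X in g X]fsetU0 gM => -[].
apply: ih => //; first by rewrite fproperD1.
by move=> t /fsetD1P[_ tB]; exact: Bi.
Qed.

End Multiplicative.

(* The balls are indexed by [S * nat] while only [S] is compared with [K]: this
   avoids the cardinal arithmetic [|S * nat| = |S|]. *)
Lemma good_ball_intersection (R : realType) (K I : Type) (U : set_system I)
    (UU : UltraFilter U) (X : I -> completeNormedModType R) (S : choiceType)
    (c : S -> nat -> ultraproduct U X) (r : S -> nat -> R) :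
  countably_incomplete U -> aleph_good K U ->
  lindenstrauss (ultraproduct U X) ->
  card_lt [set: S] [set: K] -> infinite_set [set: S] ->
  (forall s n s' n', `|c s n - c s' n'| <= r s n + r s' n') ->
  exists z, forall s n, `|z - c s n| <= r s n.
Proof.
move=> [J [UJ decJ J0]] Ugood EL SK Sinf cr.
have r0 s n : 0 <= r s n by have := cr s n s n; rewrite subrr normr0; lra.
have homoJ m n : (m <= n)%N -> J n `<=` J m.
  move=> /subnK <-; elim: (n - m)%N => // k ih i; rewrite addSn => /decJ.
  exact: ih.
have /choice[x xE] (p : S * nat) : exists x, quot_pi (@c0 R I U X _) x = c p.1 p.2.
  exact: quot_pi_surj.
pose tol (A : {fset S}) : R := (#|` A|.+1%:R)^-1.
have tol0 A : 0 < tol A by rewrite invr_gt0.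
have tol_le A B : (A `<=` B)%fset -> tol B <= tol A.
  move=> AB; rewrite lef_pV2 ?posrE// ler_nat ltnS; exact: fsubset_leq_card.
(* A finite [A] imposes finitely many conditions, since [n] stops at the cardinality of [A]. Growing
   [A] reaches every ball and sends the tolerance to 0. *)
pose close (A : {fset S}) i (z : X i) := forall s n, s \in A ->
  (n <= #|` A|)%N -> `|z - x (s, n) i| < r s n + tol A.
have close_sub A B i z : (A `<=` B)%fset -> close B i z -> close A i z.
  move=> AB zB s n sA nA; rewrite (lt_le_trans (zB s n _ _))//.
  - exact: (fsubsetP AB).
  - by rewrite (leq_trans nA)// fsubset_leq_card.
  - by rewrite lerD2l tol_le.
pose f A := J #|` A| `&` [set i | exists z, close A i z].
have Uf A : U (f A).
  apply: filterI => //.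
  pose s := [seq (a, n) | a <- enum_fset A, n <- iota 0 #|` A|.+1].
  (* Half the tolerance leaves room for the strict inequality that passes to the coordinates. *)
  have [||z zs] := @lindenstrauss_finite_balls _ (ultraproduct U X)
    [seq (c p.1 p.2, r p.1 p.2) | p <- s] (tol A / 2) EL.
  - by rewrite divr_gt0.
  - by move=> _ _ /mapP[p _ ->] /mapP[q _ ->]; exact: cr.
  have [z' z'E] : exists x, quot_pi (@c0 R I U X _) x = z by exact: quot_pi_surj.
  have := @near_seq _ U _ _ s
    (fun p => [set i | `|(z' - x p) i| < r p.1 p.2 + tol A]).
  have /[swap]/[apply] : forall p, p \in s ->
      U [set i | `|(z' - x p) i| < r p.1 p.2 + tol A].
    move=> p ps; apply: near_coord_lt; rewrite quot_piD quot_piN xE z'E.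
    rewrite (le_lt_trans (zs (c p.1 p.2, r p.1 p.2) _))//=.
      by apply/mapP; exists p.
    by rewrite ltrD2l ltr_pdivrMr// ltr_pMr// ltr1n.
  apply: filterS => i zi; exists (z' i) => a n aA nA; apply: (zi (a, n)).
  by apply: allpairs_f; rewrite // mem_iota.
have fmono : fin_monotone f.
  move=> A B AB i [Ji [z zi]]; split; last by exists z; exact: close_sub zi.
  by apply: homoJ Ji; exact: fsubset_leq_card.
have [g [Ug gM gf]] := Ugood S SK f Uf fmono.
(* The set of indices [n] with [J n i] is bounded, which bounds the cardinality
   of the finite sets [B] with [g B i]. *)
have gfin i : finite_set [set s | g [fset s]%fset i].
  have [n nJ] : exists n, ~ J n i.
    by apply/existsNP => Ji; suff : set0 i by []; rewrite -J0.
  apply: contrapT => /(infinite_set_fset n.+1)[B Bi nB].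
  have /gf[Ji _] : g B i.
    apply: (fin_multiplicative_mem gM) => [|s sB]; last exact: Bi.
    by rewrite -cardfs_gt0 (leq_trans _ nB).
  by apply: nJ; apply: homoJ Ji; exact: ltnW.
have [s0 _] : exists s, [set: S] s by apply: infinite_setN0.
(* One point serves all [C] at once: it is chosen for the largest finite set [B], made of all [s]
   with [g [fset s] i]. The fixed [s0] makes [B] nonempty; off [g [fset s0]] the value is 0, so the
   ball indexed by [(s0, 0)] bounds the whole family. *)
have /(_ _)/cid zP i : exists z : X i,
    (~ g [fset s0]%fset i -> z = 0) /\
    forall C : {fset S}, s0 \in C -> g C i -> close C i z.
  have [gi|gi] := pselect (g [fset s0]%fset i); last first.
    exists 0; split=> // C s0C /(fin_multiplicative1 gM s0C) /gi[].
  pose B := fset_set [set s | g [fset s]%fset i].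
  have BE s : (s \in B) = (g [fset s]%fset i) :> Prop.
    by rewrite in_fset_set// in_setE.
  have /gf[_ [z zB]] : g B i.
    apply: (fin_multiplicative_mem gM) => [|s]; last by rewrite BE.
    by apply/fset0Pn; exists s0; rewrite BE.
  exists z; split=> // C s0C Ci; apply: close_sub zB; apply/fsubsetP => s sC.
  by rewrite BE; exact: (fin_multiplicative1 gM sC Ci).
pose z i := projT1 (zP i).
have z0 i : ~ g [fset s0]%fset i -> z i = 0 by have [] := projT2 (zP i).
have zC i C : s0 \in C -> g C i -> close C i (z i).
  by have [_] := projT2 (zP i); exact.
have zb : exists M : R, forall i, `|z i| <= M.
  exists (`|x (s0, 0%N)| + (r s0 0%N + 1)) => i.
  have [gi|/z0->] := pselect (g [fset s0]%fset i); last first.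
    by rewrite normr0 !addr_ge0.
  rewrite -(subrKC (x (s0, 0%N) i) (z i)) (le_trans (ler_normD _ _))//.
  rewrite lerD ?linfty_coord_le// (le_trans (ltW (zC i _ _ gi s0 0%N _ _)))//.
  - by rewrite inE.
  - by rewrite inE.
  - by rewrite lerD2l invf_le1 ?ler1n.
exists (quot_pi (@c0 R I U X _) (Linfty zb) : ultraproduct U X) => s n.
rewrite -(xE (s, n)) -quot_piN -quot_piD; apply: quot_norm_near_le => // e e0.
have [N Ne] : exists N : nat, N.+1%:R^-1 < e.
  by have /ltr_add_invr[N] := e0; exists N; rewrite -[ltLHS]add0r.
have [C _ CN] := infinite_set_fset (maxn n N) Sinf.
pose D := (s0 |` (s |` C))%fset.
have CD : (C `<=` D)%fset.
  by rewrite /D (fsubset_trans (fsubsetU1 s C))// fsubsetU1.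
have nD : (maxn n N <= #|` D|)%N by rewrite (leq_trans CN)// fsubset_leq_card.
apply: filterS (Ug D) => i Di.
apply/ltW/(lt_le_trans (zC i D _ Di s n _ _)).
- by rewrite !inE eqxx.
- by rewrite !inE eqxx orbT.
- by rewrite (leq_trans _ nD)// leq_maxl.
rewrite lerD2l (le_trans _ (ltW Ne))// lef_pV2 ?posrE// ler_nat ltnS.
by rewrite (leq_trans _ nD)// leq_maxr.
Qed.

(** * Linear extension, one vector at a time *)

(** The first hypothesis is purely metric: [h] is any Lipschitz map on a nonempty set. This
    separates linearity, treated here, from the intersection of balls. *)
Lemma lipschitz_extension_linear (R : realType) (V E : normedModType R) (M : R)
    (Y : closed_subspace V) (t : {linear sub_space Y -> E}) :
  (forall (W : set V) (h : V -> E) x, W !=set0 ->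
    (forall v w, W v -> W w -> `|h v - h w| <= M * `|v - w|) ->
    exists z, forall w, W w -> `|z - h w| <= M * `|x - w|) ->
  (forall y, `|t y| <= M * `|y|) ->
  exists T : {linear V -> E},
    (forall y, T (subspace_val y) = t y) /\ forall v, `|T v| <= M * `|v|.
Proof.
move=> ext tM.
(* A partial extension of norm at most [M] is a linear subspace [G] of [V * E];
   the norm bound makes [G] the graph of a function. *)
pose good (G : set (V * E)) := [/\ forall y, G (subspace_val y, t y),
  forall (a : R) v e w f, G (v, e) -> G (w, f) -> G (a *: v + w, a *: e + f) &
  forall v e, G (v, e) -> `|e| <= M * `|v|].
have [G [Ggood Gmax]] : exists G, (G = set0 \/ good G) /\
    forall H, G `<` H -> ~ (H = set0 \/ good H).
  apply: (@Zorn_bigcup _ (fun G => G = set0 \/ good G)) => F FP Ftot.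
  have [F0|/existsNP[G0 /not_implyP[FG0 G00]]] :=
    pselect (forall G, F G -> G = set0).
    by left; apply/seteqP; split=> // p [G /F0 ->].
  have Fgood G p : F G -> G p -> good G.
    by move=> /FP[->|].
  have [//|[G0t G0lin G0M]] := FP _ FG0; right; split.
  - by move=> y; exists G0.
  - move=> a v e w f [G FG Ge] [H FH Hf].
    have [GH|HG] := Ftot _ _ FG FH.
      by exists H => //; have [_ + _] := Fgood _ _ FH Hf; apply; first exact: GH.
    by exists G => //; have [_ + _] := Fgood _ _ FG Ge; apply; last exact: HG.
  - by move=> v e [G FG Ge]; have [_ _ +] := Fgood _ _ FG Ge; exact.
pose graph := [set p : V * E | exists y, p = (subspace_val y, t y)].
have good_graph : good graph.
  split=> [y|a _ _ _ _ [y [-> ->]] [y' [-> ->]]|_ _ [y [-> ->]]].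
  - by exists y.
  - by exists (a *: y + y'); rewrite linearP.
  - by rewrite (le_trans (tM y)).
have {Ggood}[G0|] := Ggood.
  have [] := Gmax graph; last by right.
  rewrite G0 properEneq; split=> //.
  by apply/eqP => /seteqP[_ /(_ (0, t 0))]; apply; exists 0.
case=> Gt Glin GM.
have GD v e w f : G (v, e) -> G (w, f) -> G (v + w, e + f).
  by move=> Ge Gf; have := Glin 1 _ _ _ _ Ge Gf; rewrite !scale1r.
have G00 : G (0, 0) by have := Gt 0; rewrite linear0.
have GZ a v e : G (v, e) -> G (a *: v, a *: e).
  by move=> Ge; have := Glin a _ _ _ _ Ge G00; rewrite !addr0.
have GB v e w f : G (v, e) -> G (w, f) -> G (v - w, e - f).
  by move=> Ge /(GZ (-1)); rewrite !scaleN1r; exact: GD.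
have Gfun v e f : G (v, e) -> G (v, f) -> e = f.
  move=> Ge Gf; have := GM _ _ (GB _ _ _ _ Ge Gf).
  by rewrite subrr normr0 mulr0 normr_le0 subr_eq0 => /eqP.
have Gtot x : exists e, G (x, e).
  apply: contrapT => Gx.
  pose W := [set v | exists e, G (v, e)].
  have /choice[h hE] v : exists e, W v -> G (v, e).
    by have [[e Ge]|nW] := pselect (W v); [exists e|exists 0].
  have [||z zP] := ext W h x.
  - by exists 0, 0.
  - by move=> v w Wv Ww; apply: GM; apply: GB; exact: hE.
  pose H := [set p : V * E |
    exists v e a, G (v, e) /\ p = (v + a *: x, e + a *: z)].
  have GH : G `<=` H.
    by move=> [v e] Ge; exists v, e, 0; rewrite !scale0r !addr0.
  apply: (Gmax H); last right.
    rewrite properEneq; split=> //; apply/eqP => GHE; apply: Gx; exists z.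
    by rewrite GHE; exists 0, 0, 1; rewrite !scale1r !add0r.
  split=> [y|a _ _ _ _ [v [e [b [Ge [-> ->]]]]] [w [f [c [Gf [-> ->]]]]]|].
  - exact: GH.
  - exists (a *: v + w), (a *: e + f), (a * b + c); split; first exact: Glin.
    by rewrite !scalerDr !scalerA !scalerDl; congr (_, _); rewrite addrACA.
  - move=> _ _ [v [e [a [Ge [-> ->]]]]].
    have [->|a0] := eqVneq a 0; first by rewrite !scale0r !addr0; exact: GM.
    (* Dividing by [a] turns the bound at [v + a *: x] into the ball condition at the point
       [- a^-1 *: v] of [W]. *)
    have Gv : G (- a^-1 *: v, - a^-1 *: e) by exact: GZ.
    have Wv : W (- a^-1 *: v) by exists (- a^-1 *: e).
    have := zP _ Wv; rewrite (Gfun _ _ _ (hE _ Wv) Gv) => zv.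
    have scaled (N : normedModType R) (u s : N) :
        `|u + a *: s| = `|a| * `|s - - a^-1 *: u|.
      by rewrite -normrZ scaleNr opprK scalerDr scalerA divff// scale1r addrC.
    by rewrite !scaled mulrCA ler_wpM2l.
have /choice[T TG] := Gtot.
have Tlin : linear T.
  by move=> a v w; apply: (Gfun (a *: v + w)) => //; exact: Glin.
exists (HB.pack T (GRing.isLinear.Build _ _ _ _ T Tlin) : {linear V -> E}).
by split=> [y|v] /=; [exact: Gfun (TG _) (Gt _)|exact: GM].
Qed.

(** * Reduction to balls indexed by a dense set *)

(** A finite set is closed, so if dense it is the whole space, which contains the distinct multiples
    [n%:R *: v]. *)
Lemma infinite_dense (R : realType) (V : normedModType R) (D : set V) (v : V) :
  dense D -> v != 0 -> infinite_set D.
Proof.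
move=> Dd v0 Dfin; apply: infinite_nat.
have Dcl : closed D.
  have /hausdorff_accessible := @norm_hausdorff _ V.
  by move=> /accessible_finite_set_closed; exact.
have DT : D = setT.
  apply/seteqP; split=> // w _; apply: contrapT => Dw.
  have [||u [/=]] := Dd (~` D); last by [].
  - by exists w.
  - exact: closed_openC.
rewrite (_ : [set: nat] = (fun n => n%:R *: v) @^-1` D); last by rewrite DT.
apply: finite_preimage => // m n _ _ /eqP.
by rewrite -subr_eq0 -scalerBl scaler_eq0 (negbTE v0) orbF subr_eq0 eqr_nat => /eqP.
Qed.

(** [D] may miss [W], so each [d] is replaced by points of [W] within [n.+1%:R^-1] of it when such
    points exist. These are dense in [W], and the Lipschitz bound carries the ball conditions to the
    limit. *)
Lemma ball_intersection_lipschitz (R : realType) (V E : normedModType R)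
    (D : set V) (M : R) : 0 <= M -> dense D ->
  (forall (c : D -> nat -> E) (r : D -> nat -> R),
    (forall d n d' n', `|c d n - c d' n'| <= r d n + r d' n') ->
    exists z, forall d n, `|z - c d n| <= r d n) ->
  forall (W : set V) (h : V -> E) x, W !=set0 ->
    (forall v w, W v -> W w -> `|h v - h w| <= M * `|v - w|) ->
  exists z, forall w, W w -> `|z - h w| <= M * `|x - w|.
Proof.
move=> M0 Dd balls W h x [w0 Ww0] hM.
have /choice[y yP] (p : D * nat) : exists y, W y /\
    forall w, W w -> `|val p.1 - w| < p.2.+1%:R^-1 ->
              `|val p.1 - y| < p.2.+1%:R^-1.
  have [[w [Ww dw]]|nw] :=
    pselect (exists w, W w /\ `|val p.1 - w| < p.2.+1%:R^-1).
    by exists w.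
  by exists w0; split=> // w Ww dw; case: nw; exists w.
have [|z zP] := balls (fun d n => h (y (d, n))) (fun d n => M * `|x - y (d, n)|).
  move=> d n d' n'; rewrite (le_trans (hM _ _ (yP _).1 (yP _).1))//.
  rewrite -mulrDr ler_wpM2l// -(subrKA x) (le_trans (ler_normD _ _))//.
  by rewrite [in leLHS]distrC.
exists z => w Ww; apply/ler_addgt0Pr => e e0.
have M1 : 0 < 4 * (M + 1) by lra.
(* Passing from [u] to [w] costs [M * |u - w|] twice, for the centre and for the radius, with
   [|u - w| <= 2 * n.+1%:R^-1]: hence the 4. The [+ 1] covers [M = 0]. *)
have [n ne] : exists n : nat, n.+1%:R^-1 < e / (4 * (M + 1)).
  have /ltr_add_invr[n] := divr_gt0 e0 M1.
  by exists n; rewrite -[ltLHS]add0r.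
have n0 : (0 : R) < n.+1%:R^-1 by rewrite invr_gt0.
have [d' [wd Dd']] : ball w (n.+1%:R^-1 : R) `&` D !=set0.
  apply: Dd; last exact: ball_open.
  by exists w; exact: ballxx.
rewrite -ball_normE/= in wd.
pose d : D := exist _ d' (mem_set Dd').
have [Wy /(_ w Ww)] := yP (d, n).
rewrite /= distrC => /(_ wd) dy.
set u := y (d, n) in Wy dy.
have wu : `|u - w| <= 2 * n.+1%:R^-1.
  rewrite -(subrKA d') (le_trans (ler_normD _ _))// mulr2n mulrDl mul1r lerD//.
    by rewrite distrC ltW.
  by rewrite distrC ltW.
have uw : M * `|u - w| <= e / 2.
  have : M * `|u - w| <= M * (2 * (e / (4 * (M + 1)))).
    by rewrite ler_wpM2l// (le_trans wu)// ler_wpM2l// ltW.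
  have -> : M * (2 * (e / (4 * (M + 1)))) = e / 2 * (M / (M + 1)).
    by field; rewrite gt_eqF//; lra.
  move=> /le_trans; apply; rewrite ler_piMr//; first by lra.
  by rewrite ler_pdivrMr; lra.
have xu : M * `|x - u| <= M * `|x - w| + M * `|u - w|.
  rewrite -mulrDr ler_wpM2l// -(subrKA w) (le_trans (ler_normD _ _))//.
  by rewrite lerD2l distrC.
rewrite -(subrKA (h u)) (le_trans (ler_normD _ _))//.
have := zP d n; have := hM _ _ Wy Ww; rewrite -/u.
lra.
Qed.

Theorem theorem5p2 (R : realType) (K I : Type) (U : set_system I)
    (UU : UltraFilter U) (X : I -> completeNormedModType R) :
  ~ countable [set: K] ->
  countably_incomplete U ->
  aleph_good K U ->
  lindenstrauss (ultraproduct U X) ->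
  aleph_injective K (ultraproduct U X).
Proof.
move=> _ Uinc Ugood EL V [D [Dd _ DK]] Y t tb.
have [T [Tt TM]] : exists T : {linear V -> ultraproduct U X},
    (forall y, T (subspace_val y) = t y) /\
    forall v, `|T v| <= opnorm t * `|v|.
  apply: lipschitz_extension_linear => [W h x W0 hM|y]; last exact: le_opnorm.
  (* The zero space is treated apart, since its dense set is finite while the ball lemma asks for an
     infinite index set. *)
  have [[v v0]|nV] := pselect (exists v : V, v != 0).
    apply: (ball_intersection_lipschitz (opnorm_ge0 tb) Dd) W0 hM => c r.
    apply: (@good_ball_intersection _ K _ _ _ _ _ c r Uinc Ugood EL).
      have DE := card_setT D.
      by rewrite /card_lt (card_le_eql DE) (card_le_eqr DE).
    rewrite (eq_finite_set (card_setT D)).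
    exact: infinite_dense v0.
  have V0 (v : V) : v = 0.
    by apply/eqP; apply: contrapT => /negP v0; apply: nV; exists v.
  by exists (h 0) => w _; rewrite (V0 x) (V0 w) !subrr !normr0 mulr0.
exists T; split=> //; first exact: bounded_opP TM.
exact: opnorm_le (opnorm_ge0 tb) TM.
Qed.
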